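(* Let $d\ge 3$, $-\frac{(d-2)^2}{4}\le a<0$, let $H_a$ be the Friedrichs extension of $-\Delta+\frac{a}{|x|^2}$ on $L^2(\mathbb{R}^d)$, put $$\sigma=\frac{d-2-\sqrt{(d-2)^2+4a}}{2},$$ and assume $0<s<d-2\sigma$. Let $1<p<\infty$ and suppose that $\alpha\in\mathbb{R}$ satisfies $$s+\sigma-\frac dp<\alpha<\frac{d}{p'}-\sigma .$$ Then there is a finite constant $C$ such that $$\bigl\||x|^{\alpha-s}u\bigr\|_{L^p(\mathbb{R}^d)}\le C\bigl\||x|^{\alpha}H_a^{s/2}u\bigr\|_{L^p(\mathbb{R}^d)}$$ for every $u$ in the spectral core (defined in the context).
   Context: Here $p'=p/(p-1)$. The spectral core consists of all functions $u=\psi(H_a)v$ with $v\in L^2(\mathbb{R}^d)$ and $\psi\in C_c^\infty((0,\infty))$, where $\psi(H_a)$ and $H_a^{s/2}$ are defined by the spectral theorem; for such $u$ one has $u=H_a^{-s/2}H_a^{s/2}u$. The inequality is understood as vacuous when its right-hand side is infinite. The following known result of Killip, Miao, Visan, Zhang and Zheng is taken as given: for $0<s<d-2\sigma$ and $x,y\neq 0$, $x\ne y$, the integral kernel of $H_a^{-s/2}$ is positive and $$H_a^{-s/2}(x,y)\simeq |x-y|^{s-d}\left(\min\left\{\frac{|x|}{|x-y|},\frac{|y|}{|x-y|},1\right\}\right)^{-\sigma},$$ where $\simeq$ means two-sided bounds with positive constants independent of $x,y$. *)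

(* Defs.v *)
From HB Require Import structures.
From mathcomp Require Import all_boot all_order all_algebra.
From mathcomp Require Import complex.
From mathcomp Require Import all_classical all_reals all_analysis.

Set Implicit Arguments.
Unset Strict Implicit.
Unset Printing Implicit Defensive.
Import Order.TTheory GRing.Theory Num.Theory.
Import numFieldNormedType.Exports.
Import ComplexField.Normc.

Local Open Scope classical_set_scope.
Local Open Scope complex_scope.
Local Open Scope ring_scope.

Definition rV_display : measure_display. Proof. exact: default_measure_display. Qed.

(* The product sigma-algebra, i.e. the Borel sets of R^n *)
Section measurable_rV.
Context {R : realType} (n : nat).

Definition rV_cylinders : set (set 'rV[R]_n) :=
  [set A | exists (i : 'I_n) (B : set R),
    measurable B /\ A = [set x : 'rV[R]_n | B (x 0 i)]].

Let rV_measurable0 : <<s rV_cylinders >> set0.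
Proof. exact: sigma_algebra0. Qed.

Let rV_measurableC A : <<s rV_cylinders >> A -> <<s rV_cylinders >> (~` A).
Proof. exact: sigma_algebraC. Qed.

Let rV_measurable_bigcup (F : (set 'rV[R]_n)^nat) :
  (forall i, <<s rV_cylinders >> (F i)) -> <<s rV_cylinders >> (\bigcup_i F i).
Proof. exact: sigma_algebra_bigcup. Qed.

HB.instance Definition _ := @isMeasurable.Build rV_display
  'rV[R]_n <<s rV_cylinders >>
  rV_measurable0 rV_measurableC rV_measurable_bigcup.

End measurable_rV.

Lemma measurable_coord (R : realType) n (i : 'I_n) :
  measurable_fun [set: 'rV[R]_n] (fun x : 'rV[R]_n => x 0 i).
Proof.
move=> _ B mB; rewrite setTI; apply: sub_sigma_algebra.
by exists i, B.
Qed.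

Lemma measurable_fun_rV (R : realType) d (T : measurableType d) n
    (f : T -> 'rV[R]_n) :
  (forall i, measurable_fun [set: T] (fun x => f x 0 i)) ->
  measurable_fun [set: T] f.
Proof.
move=> mf; apply: (measurability (@rV_cylinders R n)) => //.
move=> _ [_ [i [B [mB ->]]] <-]; exact: (mf i).
Qed.

Section lebesgue_rV.
Context {R : realType}.

Definition rV_cons n (z : R * 'rV[R]_n) : 'rV[R]_n.+1 := row_mx z.1%:M z.2.

Lemma measurable_rV_cons n : measurable_fun setT (@rV_cons n).
Proof.
apply: measurable_fun_rV => i; rewrite /rV_cons.
case: (split_ordP (i : 'I_(1 + n))) => j ->.
  rewrite (_ : (fun _ => _) = fst)//; apply/funext => z.
  by rewrite [LHS](row_mxEl z.1%:M z.2) mxE ord1 eqxx mulr1n.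
rewrite (_ : (fun _ => _) = (fun x : 'rV[R]_n => x 0 j) \o snd).
  by apply: measurableT_comp => //; exact: measurable_coord.
by apply/funext => z; exact: (row_mxEr z.1%:M z.2).
Qed.

Definition rV_uncons n (x : 'rV[R]_n.+1) : R * 'rV[R]_n :=
  (x 0 ord0, rsubmx (x : 'rV_(1 + n))).

Lemma rV_consK n : cancel (@rV_cons n) (@rV_uncons n).
Proof.
move=> [r x]; rewrite /rV_uncons /rV_cons; congr pair; last exact: row_mxKr.
rewrite (_ : ord0 = (lshift n (ord0 : 'I_1) : 'I_(1 + n))); last exact/val_inj.
by rewrite [LHS](row_mxEl r%:M x) mxE eqxx mulr1n.
Qed.

Lemma measurable_rV_uncons n : measurable_fun setT (@rV_uncons n).
Proof.
apply/measurable_fun_pair => /=; first exact: measurable_coord.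
apply: measurable_fun_rV => i.
under eq_fun do rewrite mxE.
exact: measurable_coord.
Qed.

Section step.
Context n (mu : {sigma_finite_measure set 'rV[R]_n -> \bar R}).

Definition lebesgue_step : set 'rV[R]_n.+1 -> \bar R :=
  pushforward (@lebesgue_measure R \x mu)%E (@rV_cons n).

HB.instance Definition _ := Measure.copy lebesgue_step
  (measure_function_pushforward__canonical__measure_function_Measure
     (@lebesgue_measure R \x mu)%E (@measurable_rV_cons n)).

Let lebesgue_step_sigma_finite : sigma_finite setT lebesgue_step.
Proof.
have /sigma_finiteP[F [TF ndF Foo]] := sigma_finiteT (@lebesgue_measure R).
have /sigma_finiteP[G [TG ndG Goo]] := sigma_finiteT mu.
exists (fun k => @rV_uncons n @^-1` (F k `*` G k)).
  rewrite -preimage_bigcup (_ : \bigcup_k _ = setT) ?preimage_setT//.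
  rewrite -setXTT TF TG predeqE => -[x y]; split.
    by move=> [k _ []/= ? ?]; split; exists k.
  move=> [/= [k _ Fkx] [l _ Gly]]; exists (maxn k l) => //; split.
    by move: x Fkx; exact/subsetPset/ndF/leq_maxl.
  by move: y Gly; exact/subsetPset/ndG/leq_maxr.
move=> k; have [mF Fk] := Foo k; have [mG Gk] := Goo k; split.
  rewrite -[X in measurable X]setTI; apply: measurable_rV_uncons => //.
  exact: measurableX.
rewrite /lebesgue_step /pushforward -comp_preimage.
rewrite (_ : _ \o _ = id); last by apply/funext => z; exact: rV_consK.
by rewrite preimage_id product_measure1E// lte_mul_pinfty// ge0_fin_numE.
Qed.

HB.instance Definition _ := @Measure_isSigmaFinite.Build _ _ _ lebesgue_step
  lebesgue_step_sigma_finite.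

End step.

Fixpoint lebesgue_rV n : {sigma_finite_measure set 'rV[R]_n -> \bar R} :=
  if n is n'.+1 then lebesgue_step (lebesgue_rV n')
  else \d_(0 : 'rV[R]_0).
End lebesgue_rV.

Lemma lebesgue_rV_box (R : realType) n (A : 'I_n -> set R) :
  (forall i, measurable (A i)) ->
  lebesgue_rV n [set x : 'rV[R]_n | forall i, A i (x 0 i)]
    = (\prod_(i < n) @lebesgue_measure R (A i))%E.
Proof.
elim: n A => [|n IH] A mA.
  rewrite big_ord0 /= diracE mem_set//= => -[].
  by [].
rewrite big_ord_recl -IH// /= /lebesgue_step /pushforward.
set B := [set x : 'rV[R]_n | _].
have mB : measurable B.
  rewrite (_ : B = \bigcap_(i in [set: 'I_n])
      ((fun x : 'rV[R]_n => x 0 i) @^-1` A (lift ord0 i))); last first.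
    by apply/seteqP; split => [x Bx i _|x Bx i]; [exact: Bx|exact: (Bx i)].
  apply: fin_bigcap_measurable => // i _; rewrite -[X in measurable X]setTI.
  exact: measurable_coord.
rewrite -product_measure1E//; last exact: mA.
congr ((@lebesgue_measure R \x lebesgue_rV n)%E _).
apply/seteqP; split => [[r x] /= Hx|[r x] [/= Ar Bx] i].
  split => [|i]; rewrite /=.
    have := Hx ord0; rewrite (_ : rV_cons _ 0 ord0 = r)//.
    by have [] := rV_consK (r, x).
  have := Hx (lift ord0 i); rewrite (_ : rV_cons _ 0 (lift ord0 i) = x 0 i)//.
  rewrite (_ : lift ord0 i = rshift 1 i :> 'I_(1 + n)); last exact/val_inj.
  exact: (row_mxEr r%:M x).
case: (unliftP ord0 i) => [j ->|->].

  rewrite (_ : rV_cons _ 0 (lift ord0 j) = x 0 j); first exact: Bx.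
  rewrite (_ : lift ord0 j = rshift 1 j :> 'I_(1 + n)); last exact/val_inj.
  exact: (row_mxEr r%:M x).
rewrite (_ : rV_cons _ 0 ord0 = r)//.
by have [] := rV_consK (r, x).
Qed.

Section complex_L2.
Context d (T : measurableType d) {R : realType}.
Variable mu : {measure set T -> \bar R}.
Implicit Types f g : T -> R[i].

Definition cmeasurable f :=
  measurable_fun setT (fun x => complex.Re (f x)) /\
  measurable_fun setT (fun x => complex.Im (f x)).

Definition cintegral f : R[i] :=
  Complex (\int[mu]_x complex.Re (f x)) (\int[mu]_x complex.Im (f x)).

Definition cLnorm (p : R) f : \bar R :=
  Lnorm mu p%:E (fun x => (normc (f x))%:E).

Definition L2 f := cmeasurable f /\ (cLnorm 2 f < +oo)%E.

Definition inner f g : R[i] := cintegral (fun x => f x * conjc (g x)).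

(* A possibly unbounded operator in L^2, given by its graph: [A f h] reads
   "f is in the domain of A and A f = h".  Elements of L^2 are represented by
   functions, and equality in L^2 is [_ = _ %[ae mu]]. *)
Definition operator := (T -> R[i]) -> (T -> R[i]) -> Prop.

(* (phi n) is a sequence in the domain of A, with A (phi n) = Aphi n, which
   converges to f in L^2 and is Cauchy for the form q(g, h) = <A g, h>;
   such f make up the domain of the closure of q. *)
Definition form_approx (A : operator) f (phi Aphi : nat -> T -> R[i]) :=
  [/\ forall n, A (phi n) (Aphi n),
      cLnorm 2 (fun x => phi n x - f x) @[n --> \oo] --> 0%E &
      forall e : R, 0 < e -> exists N, forall n m, (N <= n)%N -> (N <= m)%N ->
        normc (inner (fun x => Aphi n x - Aphi m x)
                     (fun x => phi n x - phi m x)) < e].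

(* The operator associated with the closure qbar of the form
   q(g, h) = <A g, h>: f is in its domain with value h iff
   qbar(f, g) = <h, g> for every g in the form domain, where
   qbar(f, g) = lim q(f_n, g_n) along approximating sequences. *)
Definition friedrichs (A : operator) : operator := fun f h =>
  [/\ L2 f, L2 h &
      exists phi Aphi, form_approx A f phi Aphi /\
      forall g gam Agam, L2 g -> form_approx A g gam Agam ->
        normc (inner (Aphi n) (gam n) - inner h g) @[n --> \oo] --> (0 : R)].

(* Absolute convergence is required pointwise because the integral of K(x, .)f
   need not converge absolutely on the whole domain of an unbounded A. *)
Definition integral_kernel (A : operator) (K : T -> T -> R) :=
  measurable_fun setT (fun z : T * T => K z.1 z.2) /\
  forall f h, A f h ->
    (\forall x \ae mu, (\int[mu]_y (`|K x y| * normc (f y))%:E < +oo)%E) ->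
    \forall x \ae mu, h x = cintegral (fun y => (K x y)%:C * f y).

End complex_L2.
Arguments operator {d} T R.

(* What the spectral theorem, in its multiplication operator form, provides
   for a self-adjoint operator H: a unitary map sp_U of L^2(mu) onto some
   L^2(sp_measure) which turns H, domain included, into multiplication by the
   real-valued function sp_mult. *)
Record spectral_rep d (T : measurableType d) (R : realType)
    (mu : {measure set T -> \bar R}) (H : operator T R) := SpectralRep {
  sp_display : measure_display;
  sp_space : measurableType sp_display;
  sp_measure : {measure set sp_space -> \bar R};
  sp_mult : sp_space -> R;
  sp_U : (T -> R[i]) -> (sp_space -> R[i]);
  sp_mult_measurable : measurable_fun setT sp_mult;
  sp_U_L2 : forall f, L2 mu f -> L2 sp_measure (sp_U f);
  sp_U_linear : forall (c : R[i]) f g, L2 mu f -> L2 mu g ->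
    sp_U (fun x => c * f x + g x)
      = (fun y => c * sp_U f y + sp_U g y) %[ae sp_measure];
  sp_U_inner : forall f g, L2 mu f -> L2 mu g ->
    inner sp_measure (sp_U f) (sp_U g) = inner mu f g;
  sp_U_onto : forall k, L2 sp_measure k ->
    exists2 f, L2 mu f & sp_U f = k %[ae sp_measure];
  sp_H : forall f h, H f h <->
    [/\ L2 mu f, L2 mu h &
        sp_U h = (fun y => (sp_mult y)%:C * sp_U f y) %[ae sp_measure]]
}.

Arguments sp_display {d T R mu H} s.
Arguments sp_space {d T R mu H} s.
Arguments sp_measure {d T R mu H} s.
Arguments sp_mult {d T R mu H} s.
Arguments sp_U {d T R mu H} s.

(* [fun_calc S phi] is (the graph of) phi(H), with domain
   {f | (phi \o sp_mult) * U f is in L^2}. *)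
Definition fun_calc d (T : measurableType d) (R : realType)
    (mu : {measure set T -> \bar R}) (H : operator T R)
    (S : spectral_rep mu H) (phi : R -> R[i]) : operator T R := fun f h =>
  [/\ L2 mu f, L2 mu h &
      sp_U S h = (fun y => phi (sp_mult S y) * sp_U S f y) %[ae sp_measure S]].

(* H `^ r for a nonnegative injective H: the values of [powR] at 0 and at
   negative numbers then play no role. *)
Definition op_power d (T : measurableType d) (R : realType)
    (mu : {measure set T -> \bar R}) (H : operator T R)
    (S : spectral_rep mu H) (r : R) : operator T R :=
  fun_calc S (fun l => (l `^ r)%:C).

Section smooth.
Context {R : realType} {V : normedModType R}.

Definition iter_derive (vs : seq V) (f : V -> R) : V -> R :=
  foldr (fun v g x => 'D_v g x) f vs.

Definition smooth (f : V -> R) := forall vs : seq V,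
  continuous (iter_derive vs f) /\
  forall x v, derivable (iter_derive vs f) x v.

Definition Cc_smooth (D : set V) (f : V -> R[i]) :=
  [/\ smooth (fun x => complex.Re (f x)), smooth (fun x => complex.Im (f x)),
      compact (closure [set x | f x != 0]) &
      closure [set x | f x != 0] `<=` D].

End smooth.

Section inverse_square.
Context {R : realType} (d : nat).
Implicit Types (x : 'rV[R]_d) (f : 'rV[R]_d -> R[i]).

(* The norm [`|x|] of the library on 'rV[R]_d is the sup norm. *)
Definition enorm x : R := Num.sqrt (\sum_(i < d) x 0 i ^+ 2).

Definition laplacian (f : 'rV[R]_d -> R) x : R :=
  \sum_(i < d) 'D_(delta_mx 0 i) ('D_(delta_mx 0 i) f) x.

(* - Delta + a / |x|^2 on C_c^oo(R^d \ {0}) *)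
Definition inverse_square (a : R) : operator 'rV[R]_d R := fun f h =>
  Cc_smooth (~` [set 0]) f /\
  forall x, h x =
    - Complex (laplacian (fun y => complex.Re (f y)) x)
              (laplacian (fun y => complex.Im (f y)) x)
    + (a / enorm x ^+ 2)%:C * f x.

Definition H_ (a : R) : operator 'rV[R]_d R :=
  friedrichs (lebesgue_rV d) (inverse_square a).

Definition hardy_sigma (a : R) : R :=
  (d%:R - 2 - Num.sqrt ((d%:R - 2) ^+ 2 + 4 * a)) / 2.

Definition riesz_profile (a s : R) x y : R :=
  enorm (x - y) `^ (s - d%:R) *
  Num.min (Num.min (enorm x / enorm (x - y)) (enorm y / enorm (x - y))) 1
    `^ (- hardy_sigma a).

Definition spectral_core (a : R) (S : spectral_rep (lebesgue_rV d) (H_ a))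
    (u : 'rV[R]_d -> R[i]) :=
  exists v psi, [/\ L2 (lebesgue_rV d) v, Cc_smooth [set l : R | 0 < l] psi &
    fun_calc S psi v u].

Definition weighted_norm (p b : R) f : \bar R :=
  cLnorm (lebesgue_rV d) p (fun x => (enorm x `^ b)%:C * f x).

End inverse_square.

(* Main.v *)
Require Import Defs.
From mathcomp Require Import all_boot all_order all_algebra.
From mathcomp Require Import complex.
From mathcomp Require Import ring lra.
From mathcomp Require Import all_classical all_reals all_analysis.
From mathcomp Require Import measurable_realfun.
Import Order.TTheory GRing.Theory Num.Theory.
Import numFieldNormedType.Exports.
Import ComplexField.Normc.
Local Open Scope classical_set_scope.
Local Open Scope ring_scope.

(** On the spectral core u = H_a^(-s/2) w with w = H_a^(s/2) u, so the kernel
    estimate bounds |u(x)| by a multiple of the integral of P(x,y) |w(y)| dy,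
    where P is the profile [riesz_profile].  The claim thus follows from the
    boundedness on L^p of the positive integral operator with kernel
      k(x,y) = |x|^(alpha-s) P(x,y) |y|^(-alpha)
    acting on |y|^alpha |w(y)| ([weighted_riesz_Lp]).

    This kernel is homogeneous of degree -d, and it is treated by Schur's test
    ([schur_test]) with the homogeneous weight h(x) = |x|^(-d/(p p')).  Since
    h^p' = |x|^(-d/p) and h^p = |x|^(-d/p'), and since P is symmetric, the two
    conditions of the test are instances of one estimate,
      int P(x,y) |y|^(-t) dy <= C |x|^(s-t)      ([riesz_profile_integral_le]),
    for t = alpha + d/p and for t = s - alpha + d/p'.  It holds when
    s + sigma < t < d - sigma, and for these two values of t that condition is
    the assumption on alpha.

    For the estimate itself, P(x,y) |y|^(-t) is at most a constant times
      |x|^(s-d+sigma) |y|^(-sigma-t)      where |y| <= |x|/2,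
      |x|^(-sigma) |y|^(s-d+sigma-t)      where |y| >= 2|x|,
      |x|^(-t) |x-y|^(s-d)                in between, where |x-y| <= 4|x|.
    The three integrals converge because t < d - sigma, s + sigma < t and 0 < s
    respectively, and they are of order |x|^(s-t).  They only involve powers of
    a distance outside or inside a ball, so summing over dyadic shells reduces
    them to the growth t^d of the volume of balls ([integral_powR_inner],
    [integral_powR_outer]).

    The same bound shows that the integral of |K(x,y)| |w(y)| dy is finite for
    almost every x, which is what allows the kernel to represent u. *)

(** * Integrals of powers of a distance *)

Lemma dyadic_bracket {R : realType} (t : R) : 1 <= t ->
  exists k : nat, 2 ^+ k <= t <= 2 ^+ k.+1.
Proof.
move=> t1; have t0 : 0 <= t by apply: le_trans t1.
have /andP[nt tn] := truncn_itv t0.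
set n := Num.truncn t in nt tn *.
have n0 : (0 < n)%N by rewrite truncn_gt0.
have /andP[kn nk] := trunc_log_bounds (isT : (1 < 2)%N) n0.
exists (trunc_log 2 n); rewrite -!natrX; apply/andP; split.
  by apply: le_trans nt; rewrite ler_nat.
by apply: (le_trans (ltW tn)); rewrite ler_nat.
Qed.

Lemma powR_expn {R : realType} (q x : R) (k : nat) : 0 <= q ->
  (q ^+ k) `^ x = (q `^ x) ^+ k.
Proof.
by move=> q0; rewrite -(powR_mulrn k q0) powRAC powR_mulrn// powR_ge0.
Qed.

(** On a shell of radius [r] the power [rho `^ (- g)] exceeds [r `^ (- g)] by a
    bounded factor only, whatever the sign of [g]; [v] is the ratio [rho / r]. *)
Lemma powR_band {R : realType} (g v : R) : 2^-1 <= v <= 2 ->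
  v `^ (- g) <= 2 `^ `|g|.
Proof.
move=> /andP[v2 v2'].
have v0 : 0 < v by apply: lt_le_trans v2; rewrite invr_gt0.
have [g0|g0] := leP 0 g; last first.
  rewrite ltr0_norm//.
  by apply: ge0_ler_powR => //; rewrite ?nnegrE ?(ltW v0)// oppr_ge0 ltW.
rewrite -mulN1r powRrM powR_inv1 ?(ltW v0)// ger0_norm//.
apply: ge0_ler_powR => //; rewrite ?nnegrE ?invr_ge0 ?(ltW v0)//.
by rewrite invf_ple// posrE.
Qed.

Section power_weights.
Context {d : measure_display} {T : measurableType d} {R : realType}.
Variables (mu : {measure set T -> \bar R}) (A n : R).
Hypothesis A0 : 0 <= A.

Let growth (rho : T -> R) := forall t : R, 0 < t ->
  (mu [set x | (rho x <= t)%R] <= (A * t `^ n)%:E)%E.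

Let measurable_le (rho : T -> R) (t : R) : measurable_fun setT rho ->
  measurable [set x | rho x <= t].
Proof.
move=> mrho; rewrite -[X in measurable X]setTI.
exact: (measurable_fun_le measurableT mrho (measurable_cst t)).
Qed.

Lemma measurable_punctured_ball (rho : T -> R) (r : R) :
  measurable_fun setT rho -> measurable [set x | 0 < rho x <= r].
Proof.
move=> mrho.
rewrite (_ : [set x | _] = [set x | rho x <= r] `\` [set x | rho x <= 0]).
  by apply: measurableD; exact: measurable_le.
apply/seteqP; split => x /=.
  by move=> /andP[x0 xr]; split=> //; apply/negP; rewrite -ltNge.
by move=> [-> /negP]; rewrite -ltNge => ->.
Qed.

(** Geometric summation over the shells of radii [q ^+ k * r], for both the
    shrinking shells ([q = 1/2]) and the growing ones ([q = 2]): a shell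
    contributes at most a constant times [(q ^+ k * r) `^ (n - g)]. *)
Lemma integral_powR_bands (rho : T -> R) (g q r : R) (D : set T) :
  measurable_fun setT rho -> growth rho -> measurable D ->
  0 < q -> 0 < r -> q `^ (n - g) < 1 ->
  (forall x, D x -> exists k : nat, q ^+ k * r / 2 <= rho x <= q ^+ k * r * 2) ->
  (\int[mu]_(x in D) (rho x `^ (- g))%:E <=
    (2 `^ `|g| * (A * 2 `^ n) / (1 - q `^ (n - g)) * r `^ (n - g))%:E)%E.
Proof.
move=> mrho mu_rho mD q0 r0 q1 bands.
have mS (u : R) : measurable [set x | rho x <= u] by exact: measurable_le.
pose a (k : nat) : R := q ^+ k * r.
have a0 k : 0 < a k by rewrite mulr_gt0// exprn_gt0.
pose c k : R := 2 `^ `|g| * a k `^ (- g).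
have c0 k : 0 <= c k by rewrite mulr_ge0 ?powR_ge0.
pose F k (x : T) : \bar R := (c k * \1_[set x | rho x <= a k * 2] x)%:E.
have F0 k x : (0 <= F k x)%E by rewrite lee_fin mulr_ge0.
have mF k : measurable_fun D (F k).
  apply/measurable_EFinP; exact: measurable_funM.
have le_series x : D x ->
    ((rho x `^ (- g))%:E <= \sum_(k <oo) F k x)%E.
  move=> /bands[k /andP[lk uk]].
  apply: (@le_trans _ _ (F k x)); last first.
    apply: le_trans (@nneseries_lim_ge _ (F ^~ x) xpredT 0 k.+1 _) => //.
    by rewrite big_nat_recr//= leeDr// sume_ge0.
  rewrite lee_fin indicE mem_set//= mulr1.
  have -> : rho x = a k * (rho x / a k).
    by rewrite mulrC divfK// gt_eqF.
  rewrite powRM ?(ltW (a0 k))//; last first.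
    rewrite divr_ge0 ?(ltW (a0 k))//.
    by apply: le_trans lk; rewrite divr_ge0// (ltW (a0 k)).
  rewrite mulrC ler_wpM2r ?powR_ge0//; apply: powR_band.
  by rewrite ler_pdivlMr// ler_pdivrMr// mulrC lk mulrC uk.
apply: (@le_trans _ _ (\int[mu]_(x in D) \sum_(k <oo) F k x)%E).
  apply: ge0_le_integral => //.
  - by move=> x _; rewrite lee_fin powR_ge0.
  - apply/measurable_EFinP; apply: (measurableT_comp (measurable_powR _)).
    exact: measurable_funTS.
  - exact: ge0_emeasurable_sum.
rewrite integral_nneseries//.
have le_term k : (\int[mu]_(x in D) F k x <=
   (2 `^ `|g| * (A * 2 `^ n) * r `^ (n - g) * (q `^ (n - g)) ^+ k)%:E)%E.
  rewrite /F; under eq_integral do rewrite EFinM.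
  rewrite ge0_integralZl_EFin//; last first.
    by apply/measurable_EFinP.
  rewrite integral_indic//.
  apply: (@le_trans _ _ ((c k)%:E * (A * (a k * 2) `^ n)%:E)%E).
    rewrite lee_pmul ?lee_fin//.
    apply: le_trans (mu_rho _ _); last by rewrite mulr_gt0.
    by apply: le_measure; rewrite ?inE//; exact: measurableI.
  rewrite -EFinM lee_fin /c powRM ?(ltW (a0 k))//.
  rewrite -powR_expn ?(ltW q0)//.
  have -> : q ^+ k = a k / r by rewrite /a mulfK// gt_eqF.
  have rk : a k `^ (n - g) = r `^ (n - g) * (a k / r) `^ (n - g).
    by rewrite -powRM ?divr_ge0 ?(ltW (a0 k)) ?(ltW r0)// mulrC divfK// gt_eqF.
  rewrite -(mulrA _ (r `^ _)) -rk powRD; last by rewrite (gt_eqF (a0 k)) implybT.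
  by rewrite le_eqVlt; apply/orP; left; apply/eqP; ring.
apply: (@le_trans _ _ (\sum_(k <oo)
   (2 `^ `|g| * (A * 2 `^ n) * r `^ (n - g) * (q `^ (n - g)) ^+ k)%:E)%E).
  apply: lee_nneseries => // k _ _; exact: integral_ge0.
set z := q `^ (n - g) in q1 *.
have z0 : 0 < z by rewrite powR_gt0.
set b := 2 `^ `|g| * (A * 2 `^ n) * r `^ (n - g).
have b0 : 0 <= b by rewrite !mulr_ge0 ?powR_ge0.
have -> : 2 `^ `|g| * (A * 2 `^ n) / (1 - z) * r `^ (n - g) = b / (1 - z).
  by rewrite /b; ring.
apply: lime_le.
  apply: is_cvg_nneseries => k _ _.
  by rewrite lee_fin mulr_ge0// exprn_ge0// ltW.
apply: nearW => k; rewrite sumEFin lee_fin.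
by apply: geometric_le_lim => //; rewrite ger0_norm// ltW.
Qed.

(** The constant must not depend on [rho]: it is used below for the distances to
    all points of the space at once. *)
Lemma integral_powR_inner (g : R) : g < n -> exists2 C : R, 0 <= C &
  forall (rho : T -> R) (r : R), measurable_fun setT rho -> growth rho -> 0 < r ->
  (\int[mu]_(x in [set x | (0 < rho x <= r)%R]) (rho x `^ (- g))%:E <=
    (C * r `^ (n - g))%:E)%E.
Proof.
move=> gn; have h1 : 2^-1 `^ (n - g) < 1 :> R.
  rewrite [ltRHS](_ : _ = 1 `^ (n - g)); last by rewrite powR1.
  apply: gt0_ltr_powR; rewrite ?nnegrE ?subr_gt0 ?invr_ge0//.
  by rewrite invf_lt1// ltr1n.
exists (2 `^ `|g| * (A * 2 `^ n) / (1 - 2^-1 `^ (n - g))).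
  by rewrite divr_ge0 ?mulr_ge0 ?powR_ge0// subr_ge0 ltW.
move=> rho r mrho mu_rho r0; apply: integral_powR_bands => //.
  exact: measurable_punctured_ball.
move=> x /= /andP[x0 xr].
have [|k /andP[lk uk]] := @dyadic_bracket _ (r / rho x).
  by rewrite ler_pdivlMr// mul1r.
exists k; rewrite exprVn; move: lk uk.
have pk : 0 < 2 ^+ k :> R by rewrite exprn_gt0.
rewrite ler_pdivlMr// ler_pdivrMr// exprS => lk uk.
rewrite (mulrC _ r); apply/andP; split.
  by rewrite !ler_pdivrMr//; lra.
by rewrite mulrAC ler_pdivlMr//; lra.
Qed.

Lemma integral_powR_outer (g : R) : n < g -> exists2 C : R, 0 <= C &
  forall (rho : T -> R) (r : R), measurable_fun setT rho -> growth rho -> 0 < r ->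
  (\int[mu]_(x in [set x | (r <= rho x)%R]) (rho x `^ (- g))%:E <=
    (C * r `^ (n - g))%:E)%E.
Proof.
move=> gn; have h1 : 2 `^ (n - g) < 1 :> R.
  rewrite -opprB powRN invf_lt1 ?powR_gt0//.
  rewrite [ltLHS](_ : _ = 1 `^ (g - n)); last by rewrite powR1.
  by apply: gt0_ltr_powR; rewrite ?nnegrE ?subr_gt0// ltr1n.
exists (2 `^ `|g| * (A * 2 `^ n) / (1 - 2 `^ (n - g))).
  by rewrite divr_ge0 ?mulr_ge0 ?powR_ge0// subr_ge0 ltW.
move=> rho r mrho mu_rho r0; apply: integral_powR_bands => //.
  rewrite -[X in measurable X]setTI.
  exact: (measurable_fun_le measurableT (measurable_cst r) mrho).
move=> x /= xr.
have [|k /andP[lk uk]] := @dyadic_bracket _ (rho x / r).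
  by rewrite ler_pdivlMr// mul1r.
exists k; move: lk uk; rewrite ler_pdivlMr// ler_pdivrMr// exprS => lk uk.
rewrite ler_pdivrMr//.
have pk : 0 < 2 ^+ k * r by rewrite mulr_gt0// exprn_gt0.
apply/andP; split; lra.
Qed.

End power_weights.

(** * The Euclidean norm and the volume of balls *)

Section euclidean_norm.
Context {R : realType} {n : nat}.
Implicit Types (x y : 'rV[R]_n).

Lemma enorm_ge0 x : 0 <= enorm x.
Proof. exact: sqrtr_ge0. Qed.

Lemma enorm_sq x : enorm x ^+ 2 = \sum_(i < n) x 0 i ^+ 2.
Proof. by rewrite sqr_sqrtr// sumr_ge0// => i _; exact: sqr_ge0. Qed.

Lemma enorm0 : enorm (0 : 'rV[R]_n) = 0.
Proof. by rewrite /enorm big1 ?sqrtr0// => i _; rewrite mxE expr0n. Qed.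

Lemma normr_coord_le_enorm x i : `|x 0 i| <= enorm x.
Proof.
rewrite -(@ler_pXn2r _ 2)// ?nnegrE ?enorm_ge0// real_normK ?num_real//.
by rewrite enorm_sq (bigD1 i)//= lerDl sumr_ge0// => j _; exact: sqr_ge0.
Qed.

Lemma enorm_eq0 x : enorm x = 0 -> x = 0.
Proof.
move=> x0; apply/rowP => i; rewrite mxE; apply/eqP.
by rewrite -normr_le0 -x0 normr_coord_le_enorm.
Qed.

Lemma enorm_gt0 x : x != 0 -> 0 < enorm x.
Proof.
move=> x0; rewrite lt_neqAle enorm_ge0 andbT.
by apply: contraNneq x0 => /esym/enorm_eq0 ->.
Qed.

Lemma enormN x : enorm (- x) = enorm x.
Proof. by congr Num.sqrt; apply: eq_bigr => i _; rewrite mxE sqrrN. Qed.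

Lemma enormBC x y : enorm (x - y) = enorm (y - x).
Proof. by rewrite -enormN opprB. Qed.

(** A triangle inequality up to a constant, immediate from the parallelogram
    identity in each coordinate. *)
Lemma enormD_sq_le x y : enorm (x + y) ^+ 2 <= 2 * (enorm x ^+ 2 + enorm y ^+ 2).
Proof.
rewrite !enorm_sq -big_split/= mulr_sumr; apply: ler_sum => i _; rewrite mxE.
by rewrite -subr_ge0 (_ : _ - _ = (x 0 i - y 0 i) ^+ 2) ?sqr_ge0//; ring.
Qed.

Lemma measurable_enorm_comp {d} {T : measurableType d} (f : T -> 'rV[R]_n) :
  (forall i, measurable_fun setT (fun t => f t 0 i)) ->
  measurable_fun setT (fun t => enorm (f t)).
Proof.
move=> mf; rewrite /enorm.
apply: measurableT_comp.
  by apply: continuous_measurable_fun; exact: sqrt_continuous.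
by apply: measurable_sum => i; exact: measurable_funX.
Qed.

Lemma measurable_enorm : measurable_fun setT (@enorm R n).
Proof. by apply: measurable_enorm_comp => i; exact: measurable_coord. Qed.

Lemma measurable_enormB :
  measurable_fun setT (fun z : 'rV[R]_n * 'rV[R]_n => enorm (z.1 - z.2)).
Proof.
apply: measurable_enorm_comp => i.
under eq_fun do rewrite !mxE.
exact: (measurable_funB (measurableT_comp (measurable_coord i) measurable_fst)
                        (measurableT_comp (measurable_coord i) measurable_snd)).
Qed.

Lemma measurable_enormBr x : measurable_fun setT (fun y => enorm (x - y)).
Proof. exact: (measurableT_comp measurable_enormB (pair1_measurable x)). Qed.

Lemma lebesgue_rV_ball_le x (t : R) : 0 < t ->
  (lebesgue_rV n [set y | (enorm (x - y) <= t)%R] <= (2 `^ n%:R * t `^ n%:R)%:E)%E.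
Proof.
move=> t0; pose B (i : 'I_n) : set R := `[x 0 i - t, x 0 i + t]%classic.
have mB i : measurable (B i) by exact: measurable_itv.
have mBox : measurable [set y : 'rV[R]_n | forall i, B i (y 0 i)].
  rewrite (_ : mkset _ =
      \bigcap_(i in [set: 'I_n]) ((fun y : 'rV[R]_n => y 0 i) @^-1` B i)).
    apply: fin_bigcap_measurable => // i _.
    by rewrite -[X in measurable X]setTI; exact: measurable_coord.
  by apply/seteqP; split => [y By i _|y By i]; [exact: By|exact: (By i)].
apply: (@le_trans _ _ (lebesgue_rV n [set y : 'rV[R]_n | forall i, B i (y 0 i)])).
  apply: le_measure; rewrite ?inE//.
  - rewrite -[X in measurable X]setTI.
    exact: (measurable_fun_le measurableT (measurable_enormBr x) (measurable_cst t)).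
  - move=> y /= yt i; rewrite /B /= in_itv/=.
    have := le_trans (normr_coord_le_enorm (x - y) i) yt.
    by rewrite !mxE ler_norml => /andP[? ?]; apply/andP; split; lra.
rewrite lebesgue_rV_box//.
have -> : (\prod_(i < n) @lebesgue_measure R (B i) = ((2 * t) ^+ n)%:E)%E.
  have bE i : lebesgue_measure (B i) = (2 * t)%:E.
    rewrite /B lebesgue_measure_itv/= lte_fin ifT; last by lra.
    by rewrite -EFinB; congr EFin; ring.
  under eq_bigr do rewrite bE.
  by elim: (n) => [|m IH]; rewrite ?big_ord0// big_ord_recl IH exprS EFinM.
by rewrite lee_fin !powR_mulrn// ?(ltW t0)// exprMn.
Qed.

Lemma lebesgue_rV_set1 x : (0 < n)%N -> lebesgue_rV n [set x] = 0%E.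
Proof.
move=> n0; rewrite (_ : [set x] = mkset (fun y => forall i, [set x 0 i] (y 0 i))).
  rewrite (@lebesgue_rV_box R n (fun i => [set x 0 i]))//; case: n n0 x => // m _ x.
  by rewrite big_ord_recl lebesgue_measure_set1 mul0e.
by apply/seteqP; split => [y -> //|y /= yx]; apply/rowP.
Qed.

Lemma ae_neq x : (0 < n)%N -> \forall y \ae lebesgue_rV n, y != x.
Proof.
move=> n0; exists [set x]; split; last by move=> y /= /negP; rewrite negbK => /eqP.
  rewrite (_ : [set x] = [set: 'rV[R]_n] `&` [set y | enorm (x - y) <= 0]).
    exact: (measurable_fun_le measurableT (measurable_enormBr x) (measurable_cst (0 : R))).
  apply/seteqP; split => [y -> /=|y /= [_ xy]]; first by rewrite subrr enorm0.
  apply/esym/eqP; rewrite -subr_eq0; apply/eqP/enorm_eq0/le_anti.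
  by rewrite xy enorm_ge0.
exact: lebesgue_rV_set1.
Qed.

End euclidean_norm.

(** * Pointwise bounds for the profile *)

Lemma powRN_le {R : realType} (g c v : R) : 0 <= g -> 0 < c -> c <= v ->
  v `^ (- g) <= c `^ (- g).
Proof.
move=> g0 c0 cv; have v0 := lt_le_trans c0 cv.
rewrite !powRN lef_pV2 ?posrE ?powR_gt0//.
by apply: ge0_ler_powR => //; rewrite nnegrE ltW.
Qed.

Lemma powRD_gt0 {R : realType} (u g h : R) : 0 < u ->
  u `^ (g + h) = u `^ g * u `^ h.
Proof. by move=> u0; rewrite powRD// (gt_eqF u0) implybT. Qed.

Lemma powR_div {R : realType} (u v g : R) : 0 <= u -> 0 <= v ->
  (u / v) `^ g = u `^ g * v `^ (- g).
Proof.
move=> u0 v0; rewrite powRM ?invr_ge0//; congr (_ * _).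
by rewrite -powR_inv1// -powRrM mulN1r.
Qed.

(** With [X], [Y], [Z] standing for |x|, |y|, |x - y|, the minimum in the profile
    is at least the ratio of the smaller to twice the larger of |x| and |y|. *)
Lemma min_ratio_powR_le {R : realType} (g m M X Y Z : R) :
  0 <= g -> 0 < m -> 0 < Z <= 2 * M -> m <= X <= M -> m <= Y <= M ->
  Num.min (Num.min (X / Z) (Y / Z)) 1 `^ (- g) <= (2 * M / m) `^ g.
Proof.
move=> g0 m0 /andP[Z0 ZM] /andP[mX XM] /andP[mY YM].
have M0 : 0 < M by lra.
have -> : (2 * M / m) `^ g = (m / (2 * M)) `^ (- g).
  by rewrite -mulN1r powRrM powR_inv1 ?invf_div// divr_ge0//; lra.
apply: powRN_le => //; first by rewrite divr_gt0//; lra.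
rewrite !le_min; apply/andP; split; [apply/andP; split|].
- by rewrite ler_pdivlMr// mulrAC ler_pdivrMr ?mulr_gt0// ler_pM//; lra.
- by rewrite ler_pdivlMr// mulrAC ler_pdivrMr ?mulr_gt0// ler_pM//; lra.
- by rewrite ler_pdivrMr ?mulr_gt0//; lra.
Qed.

Lemma ler_of_sqr {R : realType} (u v : R) : 0 <= v -> u ^+ 2 <= v ^+ 2 -> u <= v.
Proof.
move=> v0 uv; have [u0|/ltW u0] := leP 0 u; last exact: le_trans v0.
by rewrite -(@ler_pXn2r _ 2).
Qed.

(** In this section [X], [Y], [Z] stand for |x|, |y|, |x - y|; all that is used of
    the geometry are the parallelogram bounds on their squares. *)
Section profile_estimates.
Context {R : realType} (D s t sg X Y Z : R).
Local Notation P :=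
  (Z `^ (s - D) * Num.min (Num.min (X / Z) (Y / Z)) 1 `^ (- sg)).

Lemma profile_near_origin : 0 <= sg -> s < D ->
  Z ^+ 2 <= 2 * (X ^+ 2 + Y ^+ 2) -> X ^+ 2 <= 2 * (Z ^+ 2 + Y ^+ 2) ->
  0 < Y <= X / 2 -> 0 <= Z ->
  P * Y `^ (- t) <=
    2 `^ (D - s) * 2 `^ sg * X `^ (s - D + sg) * Y `^ (- (sg + t)).
Proof.
move=> sg0 sD ZXY XZY /andP[Y0 YX] Z0; have X0 : 0 < X by lra.
have YX2 : Y ^+ 2 <= (X / 2) ^+ 2 by rewrite ler_pXn2r ?nnegrE//; lra.
have XZ : X / 2 <= Z by apply: ler_of_sqr => //; nra.
have ZX : Z <= 2 * X by apply: ler_of_sqr; [lra|nra].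
apply: (@le_trans _ _ ((X / 2) `^ (s - D) * (2 * X / Y) `^ sg * Y `^ (- t))).
  rewrite ler_wpM2r ?powR_ge0// ler_pM ?powR_ge0//.
    by rewrite -(opprB D); apply: powRN_le; lra.
  by apply: min_ratio_powR_le; lra.
rewrite !powR_div ?mulr_ge0 ?(ltW X0) ?(ltW Y0)// powRM ?(ltW X0) ?(ltW Y0)// opprB opprD.
rewrite !powRD_gt0//.
by rewrite le_eqVlt; apply/orP; left; apply/eqP; ring.
Qed.

Lemma profile_far : 0 <= sg -> s < D ->
  Z ^+ 2 <= 2 * (X ^+ 2 + Y ^+ 2) -> Y ^+ 2 <= 2 * (Z ^+ 2 + X ^+ 2) ->
  0 < X -> 2 * X <= Y -> 0 <= Z ->
  P * Y `^ (- t) <=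
    2 `^ (D - s) * 2 `^ sg * X `^ (- sg) * Y `^ (- (D - s - sg + t)).
Proof.
move=> sg0 sD ZXY YZX X0 XY Z0; have Y0 : 0 < Y by lra.
have XY2 : X ^+ 2 <= (Y / 2) ^+ 2 by rewrite ler_pXn2r ?nnegrE//; lra.
have YZ : Y / 2 <= Z by apply: ler_of_sqr => //; nra.
have ZY : Z <= 2 * Y by apply: ler_of_sqr; [lra|nra].
apply: (@le_trans _ _ ((Y / 2) `^ (s - D) * (2 * Y / X) `^ sg * Y `^ (- t))).
  rewrite ler_wpM2r ?powR_ge0// ler_pM ?powR_ge0//.
    by rewrite -(opprB D); apply: powRN_le; lra.
  by apply: min_ratio_powR_le; lra.
rewrite !powR_div ?mulr_ge0 ?(ltW X0) ?(ltW Y0)// powRM ?(ltW X0) ?(ltW Y0)// opprB.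
have -> : - (D - s - sg + t) = (s - D) + sg + (- t) by ring.
rewrite !(powRD_gt0 Y)//.
by rewrite le_eqVlt; apply/orP; left; apply/eqP; ring.
Qed.

Lemma profile_comparable : 0 <= sg -> 0 <= t ->
  Z ^+ 2 <= 2 * (X ^+ 2 + Y ^+ 2) -> 0 < X -> X / 2 <= Y <= 2 * X -> 0 < Z ->
  P * Y `^ (- t) <= 8 `^ sg * 2 `^ t * X `^ (- t) * Z `^ (- (D - s)).
Proof.
move=> sg0 t0 ZXY X0 /andP[XY YX] Z0.
have YX2 : Y ^+ 2 <= (2 * X) ^+ 2 by rewrite ler_pXn2r ?nnegrE//; lra.
have ZX : Z <= 4 * X by apply: ler_of_sqr; [lra|nra].
apply: (@le_trans _ _ (Z `^ (s - D) * 8 `^ sg * (X / 2) `^ (- t))).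
  rewrite ler_pM ?mulr_ge0 ?powR_ge0//; last by apply: powRN_le; lra.
  rewrite ler_wpM2l ?powR_ge0//.
  (* here |x| and |y| lie between |x|/2 and 2|x| *)
  have -> : 8 = 2 * (2 * X) / (X / 2) by field; lra.
  by apply: min_ratio_powR_le; lra.
rewrite powR_div ?(ltW X0)// opprK opprB.
by rewrite le_eqVlt; apply/orP; left; apply/eqP; ring.
Qed.

End profile_estimates.

(** * The profile integrated against a power *)

(** Subadditivity of the integral for overlapping domains: the three pieces need
    not be disjoint, so the borderline points belong to any of them. *)
Lemma ge0_integral_le_cover3 {d} {T : measurableType d} {R : realType}
    (mu : {measure set T -> \bar R}) (f F1 F2 F3 : T -> R) (D1 D2 D3 : set T)
    (b1 b2 b3 : R) :
  measurable_fun setT f -> (forall y, 0 <= f y) ->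
  measurable_fun setT F1 -> measurable_fun setT F2 -> measurable_fun setT F3 ->
  (forall y, 0 <= F1 y) -> (forall y, 0 <= F2 y) -> (forall y, 0 <= F3 y) ->
  measurable D1 -> measurable D2 -> measurable D3 ->
  0 <= b1 -> 0 <= b2 -> 0 <= b3 ->
  (forall y, [\/ f y = 0, D1 y /\ f y <= b1 * F1 y, D2 y /\ f y <= b2 * F2 y |
              D3 y /\ f y <= b3 * F3 y]) ->
  (\int[mu]_y (f y)%:E <= b1%:E * \int[mu]_(y in D1) (F1 y)%:E +
     b2%:E * \int[mu]_(y in D2) (F2 y)%:E + b3%:E * \int[mu]_(y in D3) (F3 y)%:E)%E.
Proof.
move=> mf f0 mF1 mF2 mF3 F10 F20 F30 mD1 mD2 mD3 b10 b20 b30 cover.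
have mG b (F : T -> R) D : measurable_fun setT F -> measurable D ->
    measurable_fun setT (fun y => b%:E * ((EFin \o F) \_ D) y)%E.
  move=> mF mD; apply: measurable_funeM.
  by apply: ((measurable_restrictT _ mD).1 (measurable_funTS _)); exact/measurable_EFinP.
have G0 b (F : T -> R) D : 0 <= b -> (forall y, 0 <= F y) ->
    forall y, (0 <= b%:E * ((EFin \o F) \_ D) y)%E.
  move=> b0 F0 y; apply: mule_ge0; rewrite ?lee_fin//.
  by apply: erestrict_ge0 => z _; rewrite lee_fin.
have GE b (F : T -> R) D : 0 <= b -> measurable_fun setT F -> measurable D ->
    (forall y, 0 <= F y) ->
    (b%:E * \int[mu]_(y in D) (F y)%:E = \int[mu]_y (b%:E * ((EFin \o F) \_ D) y))%E.
  move=> b0 mF mD F0; rewrite integral_mkcond ge0_integralZl_EFin//.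
    by move=> y _; apply: erestrict_ge0 => z _; rewrite lee_fin.
  by apply: ((measurable_restrictT _ mD).1 (measurable_funTS _)); exact/measurable_EFinP.
have m1 := mG b1 F1 D1 mF1 mD1; have m2 := mG b2 F2 D2 mF2 mD2.
have m3 := mG b3 F3 D3 mF3 mD3; have m12 := emeasurable_funD m1 m2.
rewrite !GE// -!ge0_integralD//;
  try (by move=> y _; rewrite ?adde_ge0 ?G0).
apply: ge0_le_integral => //.
- by move=> y _; rewrite lee_fin.
- exact/measurable_EFinP.
- exact: (emeasurable_funD m12 m3).
move=> y _; have [->|[Dy fy]|[Dy fy]|[Dy fy]] := cover y.
- by rewrite !adde_ge0// G0.
- apply: (@le_trans _ _ (b1%:E * ((EFin \o F1) \_ D1) y)%E).
    by rewrite patchE (mem_set Dy) -EFinM lee_fin.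
  by rewrite -addeA leeDl// adde_ge0// G0.
- apply: (@le_trans _ _ (b2%:E * ((EFin \o F2) \_ D2) y)%E).
    by rewrite patchE (mem_set Dy) -EFinM lee_fin.
  by rewrite addeAC leeDr// adde_ge0// G0.
- apply: (@le_trans _ _ (b3%:E * ((EFin \o F3) \_ D3) y)%E).
    by rewrite patchE (mem_set Dy) -EFinM lee_fin.
  by rewrite leeDr// adde_ge0// G0.
Qed.

Section riesz_profile.
Context {R : realType} {d : nat} (a s : R).
Local Notation sg := (hardy_sigma d a).
Local Notation P := (@riesz_profile R d a s).
Implicit Types x y : 'rV[R]_d.

Lemma riesz_profileC x y : P x y = P y x.
Proof. by rewrite /riesz_profile enormBC [Num.min (_ / _) _]minC. Qed.

Lemma riesz_profile_ge0 x y : 0 <= P x y.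
Proof. by rewrite mulr_ge0// powR_ge0. Qed.

(** With the conventions [0 `^ r = 0] for [r != 0] and [x / 0 = 0], the profile
    vanishes on its singular set x = 0, y = 0, x = y.  The estimates below thus
    hold at every point, without almost-everywhere qualifications. *)
Lemma riesz_profile0l y : 0 < sg -> P 0 y = 0.
Proof.
move=> sg0; rewrite /riesz_profile enorm0 mul0r.
rewrite [Num.min 0 _]min_l ?divr_ge0 ?enorm_ge0//.
by rewrite min_l// (@powR0 _ (- _)) ?mulr0// oppr_eq0 gt_eqF.
Qed.

Lemma riesz_profile0r x : 0 < sg -> P x 0 = 0.
Proof. by move=> sg0; rewrite riesz_profileC riesz_profile0l. Qed.

Lemma riesz_profile_diag x : s < d%:R -> P x x = 0.
Proof.
move=> sd; rewrite /riesz_profile subrr enorm0 powR0 ?mul0r//.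
by rewrite subr_eq0 lt_eqF.
Qed.

Lemma measurable_riesz_profile :
  measurable_fun setT (fun z : 'rV[R]_d * 'rV[R]_d => P z.1 z.2).
Proof.
have minv (f : 'rV[R]_d * 'rV[R]_d -> 'rV[R]_d) : measurable_fun setT f ->
    measurable_fun setT (fun z => enorm (f z) / enorm (z.1 - z.2)).
  move=> mf; under eq_fun do rewrite -powR_inv1 ?enorm_ge0//.
  apply: measurable_funM; first exact: (measurableT_comp measurable_enorm mf).
  exact: (measurableT_comp (measurable_powR _) measurable_enormB).
apply: measurable_funM.
  exact: (measurableT_comp (measurable_powR _) measurable_enormB).
apply: (measurableT_comp (measurable_powR _)).
apply: measurable_minr => //; apply: measurable_minr.
  exact: (minv fst measurable_fst).
exact: (minv snd measurable_snd).
Qed.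

Lemma enorm_quasi x y :
  [/\ enorm (x - y) ^+ 2 <= 2 * (enorm x ^+ 2 + enorm y ^+ 2),
      enorm x ^+ 2 <= 2 * (enorm (x - y) ^+ 2 + enorm y ^+ 2) &
      enorm y ^+ 2 <= 2 * (enorm (x - y) ^+ 2 + enorm x ^+ 2)].
Proof.
split.
- by rewrite -(enormN y) enormD_sq_le.
- by rewrite -[in leLHS](subrK y x) enormD_sq_le.
- by rewrite enormBC -[in leLHS](subrK x y) enormD_sq_le.
Qed.

(** The profile behaves like an operator of order [- s] on powers of |y|.  The
    lower bound on [t] gives convergence at infinity, the upper bound gives
    convergence at the origin. *)
Lemma riesz_profile_integral_le (t : R) :
  0 < sg -> 0 < s -> s + sg < t -> t < d%:R - sg ->
  exists2 C : R, 0 <= C & forall x,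
    (\int[lebesgue_rV d]_y (P x y * enorm y `^ (- t))%:E <=
      (C * enorm x `^ (s - t))%:E)%E.
Proof.
move=> sg0 s0 t_gt t_lt.
have [h1 h2 h3 h4] : [/\ s < d%:R, sg + t < d%:R,
    d%:R < d%:R - s - sg + t & d%:R - s < d%:R].
  move: sg0 t_gt t_lt; move: sg (d%:R : R) => u D u0 ? ?.
  by split=> //; lra.
have [C1 C10 HC1] := integral_powR_inner (lebesgue_rV d) (2 `^ d%:R) d%:R
  (powR_ge0 _ _) (sg + t) h2.
have [C2 C20 HC2] := integral_powR_outer (lebesgue_rV d) (2 `^ d%:R) d%:R
  (powR_ge0 _ _) (d%:R - s - sg + t) h3.
have [C3 C30 HC3] := integral_powR_inner (lebesgue_rV d) (2 `^ d%:R) d%:R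
  (powR_ge0 _ _) (d%:R - s) h4.
pose c1 : R := 2 `^ (d%:R - s) * 2 `^ sg.
pose c3 : R := 8 `^ sg * 2 `^ t.
have c10 : 0 <= c1 by rewrite mulr_ge0 ?powR_ge0.
have c30 : 0 <= c3 by rewrite mulr_ge0 ?powR_ge0.
exists (c1 * (C1 * 2 `^ (- (d%:R - (sg + t)))) +
        c1 * (C2 * 2 `^ (d%:R - (d%:R - s - sg + t))) +
        c3 * (C3 * 4 `^ (d%:R - (d%:R - s)))).
  by rewrite !addr_ge0// !mulr_ge0 ?powR_ge0.
move=> x; have [->|x0] := eqVneq x 0.
  under eq_integral do rewrite riesz_profile0l// mul0r.
  rewrite integral0 lee_fin mulr_ge0 ?powR_ge0//.
  by rewrite !addr_ge0// !mulr_ge0 ?powR_ge0.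
have X0 := enorm_gt0 _ x0.
pose D1 : set 'rV[R]_d := [set y | 0 < enorm y <= enorm x / 2].
pose D2 : set 'rV[R]_d := [set y | 2 * enorm x <= enorm y].
pose D3 : set 'rV[R]_d := [set y | 0 < enorm (x - y) <= 4 * enorm x].
pose b1 := c1 * enorm x `^ (s - d%:R + sg).
pose b2 := c1 * enorm x `^ (- sg).
pose b3 := c3 * enorm x `^ (- t).
have b10 : 0 <= b1 by rewrite mulr_ge0 ?powR_ge0.
have b20 : 0 <= b2 by rewrite mulr_ge0 ?powR_ge0.
have b30 : 0 <= b3 by rewrite mulr_ge0 ?powR_ge0.
have mB := measurable_enormBr x.
have mD2 : measurable D2.
  rewrite -[X in measurable X]setTI.
  exact: (measurable_fun_le measurableT (measurable_cst (2 * enorm x)) measurable_enorm).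
have mpow (f : 'rV[R]_d -> R) (e : R) : measurable_fun setT f ->
    measurable_fun setT (fun y => f y `^ e).
  by move=> mf; exact: (measurableT_comp (measurable_powR _) mf).
apply: le_trans.
  apply: (@ge0_integral_le_cover3 _ _ _ (lebesgue_rV d) _
    (fun y => enorm y `^ (- (sg + t)))
    (fun y => enorm y `^ (- (d%:R - s - sg + t)))
    (fun y => enorm (x - y) `^ (- (d%:R - s))) D1 D2 D3 b1 b2 b3).
  - apply: measurable_funM; last exact: mpow measurable_enorm.
    exact: (measurableT_comp measurable_riesz_profile (pair1_measurable x)).
  - by move=> y; rewrite mulr_ge0 ?riesz_profile_ge0 ?powR_ge0.
  - exact: mpow measurable_enorm.
  - exact: mpow measurable_enorm.
  - exact: mpow mB.
  - by move=> y; exact: powR_ge0.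
  - by move=> y; exact: powR_ge0.
  - by move=> y; exact: powR_ge0.
  - exact: (measurable_punctured_ball _ _ measurable_enorm).
  - exact: mD2.
  - exact: (measurable_punctured_ball _ _ mB).
  - exact: b10.
  - exact: b20.
  - exact: b30.
  move=> y; have [->|y0] := eqVneq y 0.
    by apply: Or41; rewrite riesz_profile0r// mul0r.
  have [<-|xy] := eqVneq x y.
    by apply: Or41; rewrite riesz_profile_diag// mul0r.
  have Y0 := enorm_gt0 _ y0.
  have Z0 : 0 < enorm (x - y) by rewrite enorm_gt0// subr_eq0.
  have [ZXY XZY YZX] := enorm_quasi x y.
  have [YX|XY] := leP (enorm y) (enorm x / 2).
    apply: Or42; split; first by rewrite /D1/= Y0 YX.
    by apply: profile_near_origin; rewrite ?Y0 ?(ltW sg0) ?(ltW Z0).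
  have [XY2|YX] := leP (2 * enorm x) (enorm y).
    apply: Or43; split; first exact: XY2.
    by apply: profile_far; rewrite ?(ltW sg0) ?(ltW Z0).
  apply: Or44; split.
    rewrite /D3/= Z0/=; apply: ler_of_sqr; first by rewrite mulr_ge0// ltW.
    have : enorm y ^+ 2 <= (2 * enorm x) ^+ 2.
      by rewrite ler_pXn2r ?nnegrE ?mulr_ge0 ?(ltW X0) ?(ltW Y0) ?(ltW YX).
    by move: ZXY; nra.
  apply: profile_comparable; rewrite ?(ltW sg0) ?(ltW XY) ?(ltW YX)//.
  by rewrite ltW// (lt_trans _ t_gt)// addr_gt0.
apply: (@le_trans _ _ (b1%:E * (C1 * (enorm x / 2) `^ (d%:R - (sg + t)))%:E +
   b2%:E * (C2 * (2 * enorm x) `^ (d%:R - (d%:R - s - sg + t)))%:E +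
   b3%:E * (C3 * (4 * enorm x) `^ (d%:R - (d%:R - s)))%:E)%E).
  have gE (r : R) : 0 < r ->
      (lebesgue_rV d [set y : 'rV[R]_d | (enorm y <= r)%R] <=
        (2 `^ d%:R * r `^ d%:R)%:E)%E.
    suff -> : [set y : 'rV[R]_d | enorm y <= r] = [set y | enorm (0 - y) <= r].
      exact: lebesgue_rV_ball_le.
    by apply/seteqP; split => y /=; rewrite sub0r enormN.
  have gB := @lebesgue_rV_ball_le R d x.
  apply: leeD; [apply: leeD|]; rewrite lee_wpmul2l ?lee_fin//.
  - by apply: HC1 => //; [exact: measurable_enorm|exact: divr_gt0].
  - by apply: HC2 => //; [exact: measurable_enorm|exact: mulr_gt0].
  - by apply: HC3 => //; exact: mulr_gt0.
rewrite -!EFinM -!EFinD lee_fin powR_div ?powRM ?(ltW X0)//.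
(* each of the three pieces is homogeneous of degree [s - t] *)
have e1 : enorm x `^ (s - t) =
    enorm x `^ (s - d%:R + sg) * enorm x `^ (d%:R - (sg + t)).
  by rewrite -powRD_gt0//; congr (_ `^ _); ring.
have e2 : enorm x `^ (s - t) =
    enorm x `^ (- sg) * enorm x `^ (d%:R - (d%:R - s - sg + t)).
  by rewrite -powRD_gt0//; congr (_ `^ _); ring.
have e3 : enorm x `^ (s - t) = enorm x `^ (- t) * enorm x `^ (d%:R - (d%:R - s)).
  by rewrite -powRD_gt0//; congr (_ `^ _); ring.
rewrite !mulrDl {1}e1 {1}e2 {1}e3 /b1 /b2 /b3.
by rewrite le_eqVlt; apply/orP; left; apply/eqP; ring.
Qed.

End riesz_profile.

(** * Schur's test *)

Section schur.
Context {d1 d2 : measure_display} {X : measurableType d1} {Y : measurableType d2}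
  {R : realType}.
Variables (mu : {sigma_finite_measure set X -> \bar R})
  (nu : {sigma_finite_measure set Y -> \bar R}).
Variables (p q A B : R) (k : X * Y -> R) (h1 : X -> R) (h2 : Y -> R).
Hypotheses (p0 : 0 < p) (q0 : 0 < q) (pq : p^-1 + q^-1 = 1).
Hypotheses (A0 : 0 <= A) (B0 : 0 <= B).
Hypotheses (mk : measurable_fun setT k) (mh1 : measurable_fun setT h1)
  (mh2 : measurable_fun setT h2).
Hypotheses (k0 : forall z, 0 <= k z) (h20 : forall y, 0 <= h2 y).
(** The weights of the application vanish at the origin by convention, where
    they should be infinite; this is harmless as the kernel vanishes there. *)
Hypothesis kh2 : forall x y, h2 y = 0 -> k (x, y) = 0.
Hypothesis row_bound : forall x,
  (\int[nu]_y (k (x, y) * h2 y `^ q)%:E <= (A * h1 x `^ q)%:E)%E.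
Hypothesis col_bound : forall y,
  (\int[mu]_x (k (x, y) * h1 x `^ p)%:E <= (B * h2 y `^ p)%:E)%E.

Let mkx x : measurable_fun setT (fun y => k (x, y)).
Proof. exact: (measurableT_comp mk (pair1_measurable x)). Qed.

(** Hoelder's inequality for the splitting
    [k * g = (k `^ q^-1 * h2) * (k `^ p^-1 * h2^-1 * g)]; the row bound controls
    the first factor. *)
Lemma schur_pointwise (g : Y -> R) (x : X) :
  measurable_fun setT g -> (forall y, 0 <= g y) ->
  ((\int[nu]_y (k (x, y) * g y)%:E) `^ p <=
    (A `^ (p / q) * h1 x `^ p)%:E *
    \int[nu]_y (k (x, y) * (h2 y `^ (- p) * g y `^ p))%:E)%E.
Proof.
move=> mg g0.
pose f y := k (x, y) `^ q^-1 * h2 y.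
pose f' y := k (x, y) `^ p^-1 * (h2 y `^ (-1) * g y).
have f0 y : 0 <= f y by rewrite mulr_ge0// powR_ge0.
have f'0 y : 0 <= f' y by rewrite !mulr_ge0// powR_ge0.
have mf : measurable_fun setT f.
  apply: measurable_funM => //.
  exact: (measurableT_comp (measurable_powR _) (mkx x)).
have mf' : measurable_fun setT f'.
  apply: measurable_funM.
    exact: (measurableT_comp (measurable_powR _) (mkx x)).
  apply: measurable_funM => //.
  exact: (measurableT_comp (measurable_powR _) mh2).
have qp : q^-1 + p^-1 = 1 by rewrite addrC.
have := hoelder nu mf mf' q0 p0 qp.
rewrite Lnorm1.
have -> : (\int[nu]_y `|(EFin \o (f \* f')%R) y| = \int[nu]_y (k (x, y) * g y)%:E)%E.
  apply: eq_integral => y _; rewrite gee0_abs/=; last by rewrite lee_fin mulr_ge0.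
  congr EFin.
  have [hy0|hy0] := eqVneq (h2 y) 0.
    by rewrite kh2// /f hy0 mulr0 !mul0r.
  rewrite /f /f' powR_inv1// mulrACA mulVKf//.
  have [->|ky0] := eqVneq (k (x, y)) 0.
    by rewrite powR0 ?mul0r// invr_eq0 gt_eqF.
  by rewrite -powRD ?ky0 ?implybT// qp powRr1.
move=> H.
have {H} : ((\int[nu]_y (k (x, y) * g y)%:E) `^ p <=
    ('N[nu]_q%:E[EFin \o f] * 'N[nu]_p%:E[EFin \o f']) `^ p)%E.
  apply: (gt0_ler_poweR (ltW p0) _ _ H).
    rewrite in_itv/= leey andbT integral_ge0// => y _.
    by rewrite lee_fin mulr_ge0.
  by rewrite in_itv/= leey andbT mule_ge0// Lnorm_ge0.
move=> H; apply: (le_trans H).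
rewrite poweRM ?Lnorm_ge0// poweR_Lnorm ?gt_eqF//.
apply: lee_pmul; rewrite ?poweR_ge0//.
- by apply: integral_ge0 => y _; rewrite poweR_ge0.
- have -> : ('N[nu]_q%:E[EFin \o f] `^ p = ('N[nu]_q%:E[EFin \o f] `^ q) `^ (p / q))%E.
    by rewrite -poweRrM mulrC divfK// gt_eqF.
  rewrite poweR_Lnorm ?gt_eqF//.
  have -> : (A `^ (p / q) * h1 x `^ p = (A * h1 x `^ q) `^ (p / q)).
    by rewrite powRM ?powR_ge0// -powRrM mulrC (mulrC q) divfK ?gt_eqF// mulrC.
  rewrite -poweR_EFin; apply: gt0_ler_poweR.
  + by rewrite divr_ge0// ltW.
  + rewrite in_itv/= leey andbT integral_ge0// => y _; exact: poweR_ge0.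
  + by rewrite in_itv/= leey andbT lee_fin mulr_ge0// powR_ge0.
  apply: le_trans (row_bound x); rewrite le_eqVlt; apply/orP; left; apply/eqP.
  apply: eq_integral => y _; rewrite gee0_abs ?lee_fin//=; congr EFin.
  by rewrite powRM ?powR_ge0// -powRrM mulVf ?gt_eqF// powRr1.
- rewrite le_eqVlt; apply/orP; left; apply/eqP.
  apply: eq_integral => y _; rewrite gee0_abs ?lee_fin//=; congr EFin.
  rewrite powRM ?mulr_ge0 ?powR_ge0// -powRrM mulVf ?gt_eqF// powRr1//.
  by rewrite powRM ?powR_ge0// -powRrM mulN1r.
Qed.

(** Integrating the pointwise bound in [x] and exchanging the integrals, the
    column bound returns the factor [h2 `^ p] that was divided out. *)
Lemma schur_test (g : Y -> R) : measurable_fun setT g -> (forall y, 0 <= g y) ->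
  (\int[mu]_x (\int[nu]_y (k (x, y) * g y)%:E) `^ p <=
    (A `^ (p / q) * B)%:E * \int[nu]_y (g y `^ p)%:E)%E.
Proof.
move=> mg g0.
pose G y := h2 y `^ (- p) * g y `^ p.
have G0 y : 0 <= G y by rewrite mulr_ge0 ?powR_ge0.
have mG : measurable_fun setT G.
  apply: measurable_funM.
    exact: (measurableT_comp (measurable_powR _) mh2).
  exact: (measurableT_comp (measurable_powR _) mg).
pose F (z : X * Y) : \bar R := (A `^ (p / q) * (h1 z.1 `^ p * (k z * G z.2)))%:E.
have F0 z : (0 <= F z)%E by rewrite lee_fin !mulr_ge0 ?powR_ge0.
have mF : measurable_fun setT F.
  apply/measurable_EFinP; apply: measurable_funM => //; apply: measurable_funM.
    exact: (measurableT_comp (measurable_powR _) (measurableT_comp mh1 measurable_fst)).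
  exact: (measurable_funM mk (measurableT_comp mG measurable_snd)).
have mkg : measurable_fun setT (fun z : X * Y => (k z * g z.2)%:E).
  apply/measurable_EFinP.
  exact: (measurable_funM mk (measurableT_comp mg measurable_snd)).
apply: (@le_trans _ _ (\int[mu]_x \int[nu]_y F (x, y))%E).
  apply: ge0_le_integral => //.
  - by move=> x _; exact: poweR_ge0.
  - apply: (measurableT_comp (measurable_poweR p)).
    apply: (measurable_fun_fubini_tonelli_F (m2 := nu) _ mkg) => z.
    by rewrite lee_fin mulr_ge0.
  - exact: (measurable_fun_fubini_tonelli_F (m2 := nu) _ mF).
  move=> x _; apply: (le_trans (schur_pointwise g x mg g0)).
  rewrite -ge0_integralZl_EFin//.
  - by under eq_integral do rewrite -EFinM -mulrA.
  - by move=> y _; rewrite lee_fin !mulr_ge0 ?powR_ge0.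
  - by apply/measurable_EFinP; exact: (measurable_funM (mkx x) mG).
  - by rewrite mulr_ge0 ?powR_ge0.
rewrite fubini_tonelli//.
rewrite -ge0_integralZl_EFin//; last 3 first.
- by move=> y _; rewrite lee_fin powR_ge0.
- by apply/measurable_EFinP; exact: (measurableT_comp (measurable_powR _) mg).
- by rewrite mulr_ge0 ?powR_ge0.
apply: ge0_le_integral => //.
- by move=> y _; exact: integral_ge0.
- exact: (measurable_fun_fubini_tonelli_G (m1 := mu) _ mF).
- apply/measurable_EFinP; apply: measurable_funM => //.
  exact: (measurableT_comp (measurable_powR _) mg).
move=> y _.
apply: (@le_trans _ _ ((A `^ (p / q) * G y)%:E * (B * h2 y `^ p)%:E)%E).
  apply: (@le_trans _ _
    ((A `^ (p / q) * G y)%:E * \int[mu]_x (k (x, y) * h1 x `^ p)%:E)%E).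
    rewrite -ge0_integralZl_EFin//.
    - rewrite le_eqVlt; apply/orP; left; apply/eqP.
      by apply: eq_integral => x _; rewrite -EFinM /F/=; congr EFin; ring.
    - by move=> x _; rewrite lee_fin mulr_ge0 ?powR_ge0.
    - apply/measurable_EFinP; apply: measurable_funM.
        exact: (measurableT_comp mk (pair2_measurable y)).
      exact: (measurableT_comp (measurable_powR _) mh1).
    - by rewrite mulr_ge0 ?powR_ge0.
  by rewrite lee_wpmul2l// lee_fin mulr_ge0 ?powR_ge0.
rewrite -!EFinM lee_fin /G.
have [hy0|hy0] := eqVneq (h2 y) 0.
  rewrite hy0 (@powR0 _ p) ?gt_eqF// !mulr0.
  by rewrite !mulr_ge0 ?powR_ge0.
rewrite powRN le_eqVlt; apply/orP; left; apply/eqP; field.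
by rewrite powR_eq0 negb_and hy0.
Qed.

End schur.

(** * Complex-valued integrals and powers of an operator *)

Section complex_integral.
Context {d : measure_display} {T : measurableType d} {R : realType}.
Variable mu : {measure set T -> \bar R}.

Lemma normc_ge0 (z : R[i]) : 0 <= normc z.
Proof. by case: z => a b; exact: sqrtr_ge0. Qed.

Lemma normr_Re_le (z : R[i]) : `|complex.Re z| <= normc z.
Proof.
by case: z => a b /=; rewrite -sqrtr_sqr ler_wsqrtr// lerDl sqr_ge0.
Qed.

Lemma normr_Im_le (z : R[i]) : `|complex.Im z| <= normc z.
Proof.
by case: z => a b /=; rewrite -sqrtr_sqr ler_wsqrtr// lerDr sqr_ge0.
Qed.

Lemma normc_le (a b : R) : normc (Complex a b) <= `|a| + `|b|.
Proof.
rewrite /= -[leRHS]ger0_norm ?addr_ge0// -sqrtr_sqr ler_wsqrtr//.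
by rewrite sqrrD !real_normK ?num_real// lerD2r lerDl mulrn_wge0// mulr_ge0.
Qed.

Lemma normc_real (x : R) : normc (real_complex R x) = `|x|.
Proof. by rewrite /= expr0n addr0 sqrtr_sqr. Qed.

Lemma measurable_normc (f : T -> R[i]) : cmeasurable f ->
  measurable_fun setT (fun x => normc (f x)).
Proof.
move=> [mRe mIm].
rewrite (_ : (fun _ => _) = fun x =>
    Num.sqrt (complex.Re (f x) ^+ 2 + complex.Im (f x) ^+ 2)); last first.
  by apply/funext => x; case: (f x).
apply: measurableT_comp.
  by apply: continuous_measurable_fun; exact: sqrt_continuous.
by apply: measurable_funD; exact: measurable_funX.
Qed.

(** Where the integral of [h] is infinite, its real-valued version takes the
    default value 0 and the bound is trivial. *)
Lemma normr_Rintegral_le (h : T -> R) : measurable_fun setT h ->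
  ((`|\int[mu]_x h x|)%:E <= \int[mu]_x (`|h x|)%:E)%E.
Proof.
move=> mh; have mE : measurable_fun setT (EFin \o h) by exact/measurable_EFinP.
apply: le_trans (le_abse_integral mu measurableT mE).
rewrite /Rintegral; move: (integral _ _ _) => [r| |] //=.
  by rewrite normr0 leey.
by rewrite normr0 leey.
Qed.

Lemma normc_cintegral_le (f : T -> R[i]) : cmeasurable f ->
  ((normc (cintegral mu f))%:E <= 2%:E * \int[mu]_x (normc (f x))%:E)%E.
Proof.
move=> mf; have [mRe mIm] := mf.
have le (h : T -> R) : measurable_fun setT h -> (forall x, `|h x| <= normc (f x)) ->
    ((`|\int[mu]_x h x|)%:E <= \int[mu]_x (normc (f x))%:E)%E.
  move=> mh hf; apply: (le_trans (normr_Rintegral_le _ mh)).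
  apply: ge0_le_integral => //.
  - by apply/measurable_EFinP; exact: (measurableT_comp (@normr_measurable R setT) mh).
  - by apply/measurable_EFinP; exact: measurable_normc.
  - by move=> x _; rewrite lee_fin.
apply: (@le_trans _ _ (`|\int[mu]_x complex.Re (f x)| +
    `|\int[mu]_x complex.Im (f x)|)%:E).
  by rewrite lee_fin normc_le.
rewrite EFinD (_ : 2 = 1 + 1 :> R)// EFinD ge0_muleDl ?lee_fin// !mul1e.
by apply: leeD; apply: le => // x; [exact: normr_Re_le|exact: normr_Im_le].
Qed.

End complex_integral.

(** On the range of [psi(H)] the powers [l `^ r] and [l `^ (- r)] are inverse to
    each other even if the spectrum of [H] reaches 0 or below, because the
    spectral transform of [u] lives where [psi], hence only where [l > 0]. *)
Lemma op_power_inv {d} {T : measurableType d} {R : realType}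
    (mu : {measure set T -> \bar R}) (H : operator T R) (S : spectral_rep mu H)
    (psi : R -> R[i]) (v u w : T -> R[i]) (r : R) :
  (forall l, psi l != 0 -> 0 < l) -> fun_calc S psi v u ->
  op_power S r u w -> op_power S (- r) w u.
Proof.
move=> psi0 [_ Lu Uu] [_ Lw Uw]; split=> //.
apply: filterS2 Uu Uw => y Uu Uw yT; rewrite Uw// {Uw}.
have [psi_y|/psi0 y0] := eqVneq (psi (sp_mult S y)) 0.
  by rewrite Uu// psi_y mul0r !mulr0.
rewrite mulrA -rmorphM/= -powRD ?addNr ?powRr0 ?rmorph1 ?mul1r//.
by rewrite (gt_eqF y0) implybT.
Qed.

Lemma hardy_sigma_gt0 {R : realType} (d : nat) (a : R) :
  (3 <= d)%N -> a < 0 -> 0 < hardy_sigma d a.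
Proof.
move=> d3 a0; rewrite /hardy_sigma divr_gt0// subr_gt0.
have D0 : 0 < d%:R - 2 :> R by rewrite subr_gt0 ltr_nat.
rewrite -[ltRHS]ger0_norm ?(ltW D0)// -sqrtr_sqr ltr_sqrt ?exprn_gt0//.
by rewrite gtrDl pmulr_rlt0.
Qed.

(** * The weighted bound for the profile *)

Section weighted_bound.
Context {R : realType} {d : nat} (a s : R).
Local Notation sg := (hardy_sigma d a).
Local Notation P := (@riesz_profile R d a s).
Implicit Types x y : 'rV[R]_d.

(** The form in which both conditions of Schur's test appear. *)
Lemma weighted_profile_integral_le (b c e : R) :
  0 < sg -> 0 < s -> s + sg < b + c -> b + c < d%:R - sg ->
  exists2 C : R, 0 <= C & forall x,
    (\int[lebesgue_rV d]_y
        (enorm x `^ e * (P x y * enorm y `^ (- b)) * enorm y `^ (- c))%:E <=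
      (C * enorm x `^ (e + s - (b + c)))%:E)%E.
Proof.
move=> sg0 s0 lt1 lt2.
have [C C0 HC] := riesz_profile_integral_le a s (b + c) sg0 s0 lt1 lt2.
exists C => // x; have [->|x0] := eqVneq x 0.
  under eq_integral do rewrite riesz_profile0l// !(mul0r, mulr0).
  by rewrite integral0 lee_fin mulr_ge0 ?powR_ge0.
have X0 := enorm_gt0 _ x0.
apply: (@le_trans _ _ ((enorm x `^ e)%:E *
    \int[lebesgue_rV d]_y (P x y * enorm y `^ (- (b + c)))%:E)%E).
  rewrite -ge0_integralZl_EFin ?powR_ge0//; last 2 first.
  - by move=> y _; rewrite lee_fin mulr_ge0 ?riesz_profile_ge0 ?powR_ge0.
  - apply/measurable_EFinP; apply: measurable_funM.
      exact: (measurableT_comp (measurable_riesz_profile a s) (pair1_measurable x)).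
    exact: (measurableT_comp (measurable_powR _) measurable_enorm).
  rewrite le_eqVlt; apply/orP; left; apply/eqP; apply: eq_integral => y _.
  rewrite -EFinM; congr EFin; have [->|y0] := eqVneq y 0.
    by rewrite riesz_profile0r// !(mul0r, mulr0).
  by rewrite opprD powRD_gt0 ?enorm_gt0//; ring.
apply: (@le_trans _ _ ((enorm x `^ e)%:E * (C * enorm x `^ (s - (b + c)))%:E)%E).
  by rewrite lee_wpmul2l ?lee_fin ?powR_ge0.
by rewrite -EFinM lee_fin mulrCA -powRD_gt0// addrA.
Qed.

Lemma weighted_riesz_Lp (p alpha : R) :
  0 < sg -> 0 < s -> 1 < p ->
  s + sg - d%:R / p < alpha -> alpha < d%:R / (p / (p - 1)) - sg ->
  exists2 M : R, 0 <= M & forall g : 'rV[R]_d -> R,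
    measurable_fun setT g -> (forall y, 0 <= g y) ->
    (\int[lebesgue_rV d]_x (\int[lebesgue_rV d]_y
        (enorm x `^ (alpha - s) * (P x y * enorm y `^ (- alpha)) * g y)%:E) `^ p <=
      M%:E * \int[lebesgue_rV d]_y (g y `^ p)%:E)%E.
Proof.
move=> sg0 s0 p1 alpha_gt alpha_lt.
pose q := p / (p - 1).
have p0 : 0 < p by rewrite (lt_trans _ p1).
have p10 : 0 < p - 1 by rewrite subr_gt0.
have q0 : 0 < q by rewrite divr_gt0.
have pq : p^-1 + q^-1 = 1.
  by rewrite /q; field; rewrite !gt_eqF.
have dq : d%:R / q = d%:R - d%:R / p :> R.
  by rewrite -[X in X - _]mulr1 -pq; ring.
have [r1 r2 r3 r4] : [/\ s + sg < alpha + d%:R / p,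
    alpha + d%:R / p < d%:R - sg, s + sg < s - alpha + d%:R / q &
    s - alpha + d%:R / q < d%:R - sg].
  rewrite -/q in alpha_lt; rewrite dq in alpha_lt *.
  move: sg0 alpha_gt alpha_lt; move: sg (d%:R / p) (d%:R : R) => u e D ? ? ?.
  by split; lra.
(* rows: t = alpha + d/p; columns, after swapping x and y: t = s - alpha + d/q *)
have [A A0 HA] := weighted_profile_integral_le alpha (d%:R / p) (alpha - s) sg0 s0 r1 r2.
have [B B0 HB] := weighted_profile_integral_le (s - alpha) (d%:R / q) (- alpha) sg0 s0 r3 r4.
pose k (z : 'rV[R]_d * 'rV[R]_d) : R :=
  enorm z.1 `^ (alpha - s) * (P z.1 z.2 * enorm z.2 `^ (- alpha)).
(* the homogeneous weight for which h^q = |x|^(-d/p) and h^p = |x|^(-d/q) *)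
pose h x : R := enorm x `^ (- (d%:R / (p * q))).
have mh : measurable_fun setT h.
  exact: (measurableT_comp (measurable_powR _) measurable_enorm).
have mk : measurable_fun setT k.
  apply: measurable_funM.
    exact: (measurableT_comp (measurable_powR _) (measurableT_comp measurable_enorm measurable_fst)).
  apply: measurable_funM; first exact: measurable_riesz_profile.
  exact: (measurableT_comp (measurable_powR _) (measurableT_comp measurable_enorm measurable_snd)).
have k0 z : 0 <= k z by rewrite !mulr_ge0 ?riesz_profile_ge0 ?powR_ge0.
have h0 x : 0 <= h x by exact: powR_ge0.
have hq x : h x `^ q = enorm x `^ (- (d%:R / p)).
  by rewrite /h -powRrM; congr (_ `^ _); field; rewrite !gt_eqF.
have hp x : h x `^ p = enorm x `^ (- (d%:R / q)).
  by rewrite /h -powRrM; congr (_ `^ _); field; rewrite !gt_eqF.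
exists (A `^ (p / q) * B); first by rewrite mulr_ge0 ?powR_ge0.
move=> g mg g0.
have Schur := schur_test (lebesgue_rV d) (lebesgue_rV d) p q A B k h h p0 q0 pq A0 B0 mk mh mh k0 h0.
apply: (Schur _ _ _ g mg g0) => {Schur}.
- move=> x y /powR_eq0_eq0/enorm_eq0 ->.
  by rewrite /k/= riesz_profile0r// mul0r mulr0.
- move=> x; under eq_integral do rewrite hq.
  apply: (le_trans (HA x)); rewrite hq lee_fin.
  by rewrite (_ : alpha - s + s - _ = - (d%:R / p))//; ring.
- move=> y; rewrite hp (_ : - (d%:R / q) = - alpha + s - (s - alpha + d%:R / q)); last by ring.
  apply: le_trans (HB y).
  rewrite le_eqVlt; apply/orP; left; apply/eqP; apply: eq_integral => x _.
  by rewrite hp /k/= riesz_profileC opprB; congr EFin; ring.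
Qed.

End weighted_bound.

(** * The weighted inequality *)

Lemma fin_poweR_integral_ae {d} {T : measurableType d} {R : realType}
    (mu : {measure set T -> \bar R}) (p : R) (F : T -> \bar R) :
  0 < p -> measurable_fun setT F -> (forall x, (0 <= F x)%E) ->
  (\int[mu]_x (F x `^ p) < +oo)%E -> \forall x \ae mu, (F x < +oo)%E.
Proof.
move=> p0 mF F0 Foo.
have intF : mu.-integrable setT (fun x => F x `^ p)%E.
  apply/integrableP; split; first exact: (measurableT_comp (measurable_poweR p) mF).
  by under eq_integral do rewrite gee0_abs ?poweR_ge0//.
apply: filterS (integrable_ae measurableT intF) => x /(_ I) fx.
apply: (@lty_poweRy _ _ p); first by rewrite gt_eqF.
by rewrite -ge0_fin_numE// poweR_ge0.
Qed.

Lemma cmeasurable_realM {d} {T : measurableType d} {R : realType} (k : T -> R)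
    (f : T -> R[i]) : measurable_fun setT k -> cmeasurable f ->
  cmeasurable (fun y => real_complex R (k y) * f y).
Proof.
move=> mk [mRe mIm]; split.
  rewrite (_ : (fun _ => _) = fun y => k y * complex.Re (f y)); last first.
    by apply/funext => y; case: (f y) => u v /=; rewrite mul0r subr0.
  exact: measurable_funM.
rewrite (_ : (fun _ => _) = fun y => k y * complex.Im (f y)); last first.
  by apply/funext => y; case: (f y) => u v /=; rewrite mul0r addr0.
exact: measurable_funM.
Qed.

Lemma weighted_normE {R : realType} {d : nat} (p b : R) (f : 'rV[R]_d -> R[i]) :
  weighted_norm p b f =
  ((\int[lebesgue_rV d]_x ((enorm x `^ b * normc (f x)) `^ p)%:E) `^ p^-1)%E.
Proof.
rewrite /weighted_norm /cLnorm unlock /Lnorm; congr (_ `^ _)%E.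
apply: eq_integral => x _; rewrite normcM normc_real ger0_norm ?powR_ge0//.
by rewrite gee0_abs// lee_fin mulr_ge0 ?powR_ge0 ?normc_ge0.
Qed.

Section riesz_dominated_kernel.
Context {R : realType} {d : nat} (a s p alpha c : R).
Local Notation sg := (hardy_sigma d a).
Local Notation P := (@riesz_profile R d a s).
Local Notation mu := (@lebesgue_rV R d).
Variable K : 'rV[R]_d -> 'rV[R]_d -> R.

(** The representation of [u] by the kernel is only assumed when the integral
    converges absolutely almost everywhere, and the proof has to establish that
    convergence first: it follows from the L^p bound for [F], the image of
    [|y|^alpha |w|] under the weighted profile. *)
Lemma weighted_norm_kernel_le : (0 < d)%N -> 0 < sg -> 0 < s -> 1 < p -> 0 <= c ->
  s + sg - d%:R / p < alpha -> alpha < d%:R / (p / (p - 1)) - sg ->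
  measurable_fun setT (fun z : 'rV[R]_d * 'rV[R]_d => K z.1 z.2) ->
  (forall x y, x != 0 -> y != 0 -> x != y -> `|K x y| <= c * P x y) ->
  exists C : R, forall u w : 'rV[R]_d -> R[i], cmeasurable u -> cmeasurable w ->
    ((\forall x \ae mu, (\int[mu]_y (`|K x y| * normc (w y))%:E < +oo)%E) ->
      \forall x \ae mu, u x = cintegral mu (fun y => real_complex R (K x y) * w y)) ->
    (weighted_norm p alpha w < +oo)%E ->
    (weighted_norm p (alpha - s) u <= C%:E * weighted_norm p alpha w)%E.
Proof.
move=> d0 sg0 s0 p1 c0 alpha_gt alpha_lt mK K_le.
have p0 : 0 < p by rewrite (lt_trans _ p1).
have [M M0 HM] := weighted_riesz_Lp a s p alpha sg0 s0 p1 alpha_gt alpha_lt.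
exists (((2 * c) `^ p * M) `^ p^-1) => u w mu_ mw uK w_fin.
pose g (y : 'rV[R]_d) := enorm y `^ alpha * normc (w y).
have mnw := measurable_normc w mw.
have mg : measurable_fun setT g.
  apply: measurable_funM => //.
  exact: (measurableT_comp (measurable_powR _) measurable_enorm).
have g0 y : 0 <= g y by rewrite mulr_ge0 ?powR_ge0 ?normc_ge0.
pose k (x y : 'rV[R]_d) : R :=
  enorm x `^ (alpha - s) * (P x y * enorm y `^ (- alpha)).
pose F x := (\int[mu]_y (k x y * g y)%:E)%E.
have k0 x y : 0 <= k x y by rewrite !mulr_ge0 ?riesz_profile_ge0 ?powR_ge0.
have F0 x : (0 <= F x)%E.
  by apply: integral_ge0 => y _; rewrite lee_fin mulr_ge0.
have mP x : measurable_fun setT (P x).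
  exact: (measurableT_comp (measurable_riesz_profile a s) (pair1_measurable x)).
have mF : measurable_fun setT F.
  apply: (measurable_fun_fubini_tonelli_F (m2 := mu)
    (fun z : 'rV[R]_d * 'rV[R]_d => (k z.1 z.2 * g z.2)%:E)).
    apply/measurable_EFinP; apply: measurable_funM.
      apply: measurable_funM.
        exact: (measurableT_comp (measurable_powR _)
          (measurableT_comp measurable_enorm measurable_fst)).
      apply: measurable_funM; first exact: measurable_riesz_profile.
      exact: (measurableT_comp (measurable_powR _)
        (measurableT_comp measurable_enorm measurable_snd)).
    exact: (measurableT_comp mg measurable_snd).
  by move=> z; rewrite lee_fin mulr_ge0.
have F_le : (\int[mu]_x (F x `^ p) <= M%:E * \int[mu]_y (g y `^ p)%:E)%E.
  exact: HM g mg g0.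
have gp_fin : (\int[mu]_y (g y `^ p)%:E < +oo)%E.
  move: w_fin; rewrite weighted_normE => /lty_poweRy; apply.
  by rewrite invr_eq0 gt_eqF.
have F_fin : \forall x \ae mu, (F x < +oo)%E.
  apply: (fin_poweR_integral_ae _ p) => //; apply: (le_lt_trans F_le).
  by rewrite lte_mul_pinfty ?lee_fin.
pose I (x : 'rV[R]_d) := (\int[mu]_y (P x y * normc (w y))%:E)%E.
have FE x : F x = ((enorm x `^ (alpha - s))%:E * I x)%E.
  rewrite -ge0_integralZl_EFin ?powR_ge0//; last 2 first.
  - by move=> y _; rewrite lee_fin mulr_ge0 ?riesz_profile_ge0 ?normc_ge0.
  - by apply/measurable_EFinP; exact: (measurable_funM (mP x) mnw).
  apply: eq_integral => y _; rewrite -EFinM; congr EFin.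
  rewrite /k /g; have [->|y0] := eqVneq y 0.
    by rewrite riesz_profile0r// !(mul0r, mulr0).
  rewrite powRN; field.
  by rewrite powR_eq0 negb_and gt_eqF// enorm_gt0.
have KI x : x != 0 ->
    (\int[mu]_y (`|K x y| * normc (w y))%:E <= c%:E * I x)%E.
  move=> x0; rewrite -ge0_integralZl_EFin//; last 2 first.
  - by move=> y _; rewrite lee_fin mulr_ge0 ?riesz_profile_ge0 ?normc_ge0.
  - by apply/measurable_EFinP; exact: (measurable_funM (mP x) mnw).
  apply: ae_ge0_le_integral => //.
  - by move=> y _; rewrite lee_fin mulr_ge0 ?normc_ge0.
  - apply/measurable_EFinP; apply: measurable_funM => //.
    apply: (measurableT_comp (@normr_measurable R setT)).
    exact: (measurableT_comp mK (pair1_measurable x)).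
  - move=> y _; apply: mule_ge0; rewrite lee_fin //.
    by rewrite mulr_ge0 ?riesz_profile_ge0 ?normc_ge0.
  - apply: measurable_funeM.
    by apply/measurable_EFinP; exact: (measurable_funM (mP x) mnw).
  - apply: filterS2 (ae_neq x d0) (ae_neq 0 d0) => y yx y0 _.
    rewrite -EFinM lee_fin mulrA ler_wpM2r ?normc_ge0//.
    by apply: K_le => //; rewrite eq_sym.
have I_fin : \forall x \ae mu, x != 0 /\ (I x < +oo)%E.
  apply: filterS2 (ae_neq 0 d0) F_fin => x x0 Fx; split=> //.
  rewrite ltey; apply/eqP => Iy; move: Fx; rewrite FE Iy gt0_muley ?ltxx//.
  by rewrite lte_fin powR_gt0// enorm_gt0.
have {}uK : \forall x \ae mu,
    u x = cintegral mu (fun y => real_complex R (K x y) * w y).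
  apply: uK; apply: filterS I_fin => x [x0 Ix].
  apply: (le_lt_trans (KI x x0)).
  by rewrite lte_mul_pinfty ?lee_fin.
have uF : \forall x \ae mu,
    ((enorm x `^ (alpha - s) * normc (u x))%:E <= (2 * c)%:E * F x)%E.
  apply: filterS2 (ae_neq 0 d0) uK => x x0 ->.
  have mKw : cmeasurable (fun y => real_complex R (K x y) * w y).
    apply: cmeasurable_realM => //.
    exact: (measurableT_comp mK (pair1_measurable x)).
  have := normc_cintegral_le mu _ mKw.
  under eq_integral do rewrite normcM normc_real.
  move=> uI; rewrite FE EFinM muleCA lee_wpmul2l ?lee_fin ?powR_ge0//.
  apply: (le_trans uI); rewrite EFinM -muleA lee_wpmul2l ?lee_fin//.
  exact: KI.
have b0 : 0 <= (2 * c) `^ p by exact: powR_ge0.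
have int_le : (\int[mu]_x ((enorm x `^ (alpha - s) * normc (u x)) `^ p)%:E <=
    ((2 * c) `^ p * M)%:E * \int[mu]_y (g y `^ p)%:E)%E.
  apply: (@le_trans _ _ (((2 * c) `^ p)%:E * \int[mu]_x (F x `^ p))%E); last first.
    by rewrite EFinM -muleA lee_wpmul2l ?lee_fin.
  rewrite -ge0_integralZl_EFin//; last 2 first.
  - by move=> x _; exact: poweR_ge0.
  - exact: (measurableT_comp (measurable_poweR p) mF).
  apply: ae_ge0_le_integral => //.
  - by move=> x _; rewrite lee_fin powR_ge0.
  - apply/measurable_EFinP; apply: (measurableT_comp (measurable_powR _)).
    apply: measurable_funM; last exact: measurable_normc.
    exact: (measurableT_comp (measurable_powR _) measurable_enorm).
  - by move=> x _; rewrite mule_ge0 ?lee_fin ?poweR_ge0.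
  - by apply: measurable_funeM; exact: (measurableT_comp (measurable_poweR p) mF).
  - apply: filterS uF => x uF _.
    rewrite -!poweR_EFin -poweRM ?lee_fin ?mulr_ge0//.
    apply: gt0_ler_poweR => //.
    + exact: ltW.
    + by rewrite in_itv/= leey andbT lee_fin mulr_ge0 ?powR_ge0 ?normc_ge0.
    + by rewrite in_itv/= leey andbT mule_ge0// lee_fin mulr_ge0.
rewrite !weighted_normE -poweR_EFin -poweRM ?lee_fin ?mulr_ge0//; last first.
  by apply: integral_ge0 => y _; rewrite lee_fin powR_ge0.
apply: gt0_ler_poweR => //.
- by rewrite invr_ge0 ltW.
- rewrite in_itv/= leey andbT; apply: integral_ge0 => x _.
  by rewrite lee_fin powR_ge0.
- rewrite in_itv/= leey andbT mule_ge0 ?lee_fin ?mulr_ge0//.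
  by apply: integral_ge0 => y _; rewrite lee_fin powR_ge0.
Qed.

End riesz_dominated_kernel.

Theorem corollary6p2 (R : realType) (d : nat) (a s p alpha : R)
  (d_ge3 : (3 <= d)%N)
  (a_ge : - ((d%:R - 2) ^+ 2 / 4) <= a) (a_lt0 : a < 0)
  (* any spectral representation of H_a; they all define the same
     functional calculus *)
  (S : spectral_rep (lebesgue_rV d) (H_ a))
  (s_gt0 : 0 < s) (s_lt : s < d%:R - 2 * hardy_sigma d a)
  (* the kernel estimate of Killip, Miao, Visan, Zhang and Zheng *)
  (kernel : exists K : 'rV[R]_d -> 'rV[R]_d -> R,
    integral_kernel (lebesgue_rV d) (op_power S (- (s / 2))) K /\
    exists c1 c2 : R, [/\ 0 < c1, 0 < c2 &
      forall x y, x != 0 -> y != 0 -> x != y ->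
        [/\ 0 < K x y,
            c1 * riesz_profile a s x y <= K x y &
            K x y <= c2 * riesz_profile a s x y]])
  (p_gt1 : 1 < p)
  (alpha_gt : s + hardy_sigma d a - d%:R / p < alpha)
  (alpha_lt : alpha < d%:R / (p / (p - 1)) - hardy_sigma d a) :
  exists C : R, forall u w : 'rV[R]_d -> R[i],
    spectral_core S u -> op_power S (s / 2) u w ->
    (weighted_norm p alpha w < +oo)%E ->
    (weighted_norm p (alpha - s) u <= C%:E * weighted_norm p alpha w)%E.
Proof.
have [K [[mK HK] [c1 [c2 [_ c2_gt0 K_le]]]]] := kernel.
have sg0 := hardy_sigma_gt0 d a d_ge3 a_lt0.
have d0 : (0 < d)%N by rewrite (leq_trans _ d_ge3).
have K_abs_le x y : x != 0 -> y != 0 -> x != y ->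
    `|K x y| <= c2 * riesz_profile a s x y.
  by move=> x0 y0 xy; have [K0 _ ?] := K_le x y x0 y0 xy; rewrite gtr0_norm.
have [C HC] := weighted_norm_kernel_le a s p alpha c2 K d0 sg0 s_gt0 p_gt1
  (ltW c2_gt0) alpha_gt alpha_lt mK K_abs_le.
exists C => u w [v [psi [_ [_ _ _ psi_supp] Uu]]] Uw.
have [[mu_ _] [mw _] _] := Uw.
have psi_pos l : psi l != 0 -> 0 < l.
  by move=> psil; apply: (psi_supp l); exact: subset_closure.
apply: HC => //; apply: HK.
exact: (op_power_inv _ _ _ psi v).
Qed.
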